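(* Every separable metrizable cut-point space densely embeds into a reducible metrizable continuum with no cut points. That is, for every separable metrizable cut-point space $X$ there exist a reducible metrizable continuum $Y$ with no cut points and a homeomorphic embedding of $X$ onto a dense subspace of $Y$.
   Context: A point $x$ of a connected space $Z$ is a cut point of $Z$ if $Z\setminus\{x\}$ is disconnected. A cut-point space is a connected topological space in which every point is a cut point. A continuum is a connected compact Hausdorff space; a subcontinuum is a subspace that is a continuum. A continuum $Y$ is reducible if for every two points $a,b\in Y$ there exists a proper subcontinuum of $Y$ containing $a$ and $b$. *)

(* Defs.v *)
From mathcomp Require Import all_boot all_order all_algebra.
From mathcomp Require Import all_classical reals topology.

Set Implicit Arguments.
Unset Strict Implicit.
Unset Printing Implicit Defensive.

Local Open Scope classical_set_scope.

Definition homeomorphic (S T : topologicalType) : Prop :=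
  exists (f : S -> T) (g : T -> S),
    [/\ cancel f g, cancel g f, continuous f & continuous g].

Definition metrizable (R : realType) (T : topologicalType) : Prop :=
  exists M : metricType R, homeomorphic T M.

Definition separable (T : topologicalType) : Prop :=
  exists2 D : set T, countable D & dense D.

Definition cut_point (T : topologicalType) (x : T) : Prop :=
  ~ connected [set~ x].

Definition cut_point_space (T : topologicalType) : Prop :=
  connected [set: T] /\ forall x : T, cut_point x.

Definition continuum (T : topologicalType) : Prop :=
  [/\ connected [set: T], compact [set: T] & hausdorff_space T].

(* The set A is coerced to the type [set_type A], which carries the subspace
   topology (the initial topology of the inclusion into T). *)
Definition subcontinuum (T : topologicalType) (A : set T) : Prop :=
  continuum A.

Definition reducible (T : topologicalType) : Prop :=
  forall a b : T, exists A : set T,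
    [/\ subcontinuum A, A <> [set: T], A a & A b].

Definition densely_embeds (S T : topologicalType) : Prop :=
  exists2 D : set T, dense D & homeomorphic S D.

(* Main.v *)
From HB Require Import structures.
Require Import Defs.
From mathcomp Require Import all_boot all_order all_algebra.
From mathcomp Require Import all_classical reals topology.
From mathcomp Require Import normedtype trigo lra.

(* Removing a point of X leaves a piece whose closure is not compact (otherwise
   Zorn's lemma on nested pieces produces a non-cut point), so in any
   compactification the piece has a remainder point. Choose countably many
   pieces W_n such that every piece contains one of them, and remainder points
   r_n of the W_n in the Hilbert cube. Adjoining the coordinates
   cos (1 / d (x, r_n)) blows each r_n up to an arc lying in the closure of W_n
   and missing X. Gluing the upper end of each arc to the lower end of the
   nearest earlier arc is an upper semicontinuous decomposition (the glued
   distances tend to 0), and only remainder points are glued, so the quotient Y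
   is a metrizable compactification of X. In Y the arcs form a connected set
   disjoint from X that touches the closure of every piece, so no point of X
   cuts Y; points of the remainder never cut. Finally W_0 and W_1 are disjoint
   but have intersecting closures; for any two points a, b of Y, one of the
   closures of the four sides of these two cuts, or the union of the closures
   of W_0 and W_1, is a proper subcontinuum containing both. *)

Set Implicit Arguments.
Unset Strict Implicit.
Unset Printing Implicit Defensive.

Import Order.TTheory GRing.Theory Num.Theory.
Import numFieldNormedType.Exports.

Local Open Scope classical_set_scope.

(** * Cuts of connected spaces *)

(** [cut_point] only negates connectedness; the record names the two sides, so that one of them can
    be kept as the piece under study. *)
Record cut {T : topologicalType} (x : T) (U V : set T) : Prop := Cut {
  cut_openl : open U;
  cut_openr : open V;
  cut_nonemptyl : U !=set0;
  cut_nonemptyr : V !=set0;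
  cut_disjoint : U `&` V = set0;
  cut_cover : U `|` V = [set~ x] }.

Lemma cutC (T : topologicalType) (x : T) U V : cut x U V -> cut x V U.
Proof. by case=> oU oV U0 V0 UV0 UVx; split; rewrite // (setIC, setUC). Qed.

Lemma setI0P (T : Type) (A B : set T) x : A `&` B = set0 -> A x -> B x -> False.
Proof. by move=> AB0 Ax Bx; suff : (A `&` B) x by rewrite AB0. Qed.

Lemma cut_or (T : topologicalType) (x y : T) U V :
  cut x U V -> y <> x -> U y \/ V y.
Proof. by move=> cx yx; have : [set~ x] y := yx; rewrite -(cut_cover cx). Qed.

Lemma cut_neql (T : topologicalType) (x : T) U V : cut x U V -> ~ U x.
Proof.
move=> cx Ux; have : (U `|` V) x by left.
by rewrite (cut_cover cx); apply.
Qed.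

Lemma cut_setC (T : topologicalType) (x : T) U V :
  cut x U V -> ~` (x |` U) = V.
Proof.
move=> cx; apply/seteqP; split=> y /=.
  move=> /not_orP[yx Uy]; case: (cut_or cx yx) => //.
move=> Vy [yx|Uy]; first by move: Vy; rewrite yx; apply: cut_neql (cutC cx).
exact: setI0P (cut_disjoint cx) Uy Vy.
Qed.

Lemma cut_closed (T : topologicalType) (x : T) U V :
  cut x U V -> closed (x |` U).
Proof. by move=> cx; rewrite -openC (cut_setC cx); exact: cut_openr cx. Qed.

Lemma open_disjoint_closure (T : topologicalType) (U V : set T) :
  open V -> U `&` V = set0 -> closure U `&` V = set0.
Proof.
move=> oV UV0; apply/disjoints_subset.
have -> : ~` V = closure (~` V) by exact/closure_id/open_closedC.
exact/closureS/disjoints_subset.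
Qed.

Lemma cut_separated (T : topologicalType) (x : T) U V :
  cut x U V -> separated U V.
Proof.
case=> oU oV _ _ UV0 _; split; first exact: open_disjoint_closure.
by rewrite setIC; apply: open_disjoint_closure; rewrite // setIC.
Qed.

Lemma separated_closedl (T : topologicalType) (A B : set T) :
  closed (A `|` B) -> separated A B -> closed A.
Proof.
move=> cAB [AB _] y Ay.
case: (cAB y (closureS (@subsetUl _ A B) Ay)) => // By.
by case: (setI0P AB Ay By).
Qed.

(** In a separation of [x] together with [U], the half without [x] is closed in [T], and its
    complement is the union of the other half with the closed set formed by [x] and [V]. That half
    is thus clopen in the connected [T]. *)
Lemma cut_connected (T : topologicalType) (x : T) U V :
  connected [set: T] -> cut x U V -> connected (x |` U).
Proof.
move=> cT cx; apply/connectedP => E [E0 WE sE].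
wlog Ex : E E0 WE sE / E false x.
  move=> H; have : (x |` U) x by left.
  rewrite WE => -[Ex|Ex]; first exact: (H E).
  apply: (H (E \o negb)) => //=.
    by rewrite WE setUC.
  by rewrite separatedC.
have cW := cut_closed cx.
have cE0 : closed (E false) by apply: separated_closedl sE; rewrite -WE.
have cE1 : closed (E true).
  apply: (@separated_closedl _ _ (E false)); last by rewrite separatedC.
    by rewrite setUC -WE.
have oE1 : open (E true).
  rewrite -closedC (_ : ~` E true = E false `|` (x |` V)).
    by apply: closedU => //; exact: cut_closed (cutC cx).
  apply/seteqP; split=> y /=.
    move=> nE; have [Wy|nW] := pselect ((x |` U) y).
      by left; move: Wy; rewrite WE => -[].
    by right; right; rewrite -(cut_setC cx).
  case=> [Ey|[->|Vy]] E1y.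
  - exact: setI0P (separated_disjoint sE) Ey E1y.
  - exact: setI0P (separated_disjoint sE) Ex E1y.
  - move: Vy; rewrite -(cut_setC cx); apply; rewrite WE; by right.
have E1T : E true = [set: T].
  by apply: cT; [exact: E0|exists (E true); rewrite ?setTI..].
by apply: (setI0P (separated_disjoint sE) Ex); rewrite E1T.
Qed.

(** Adjoining [x] to a half gives a closed set, since separation keeps limit points out of the other
    half. Each half is the complement of the other one so enlarged, hence open. *)
Lemma cut_of_cut_point (T : topologicalType) (x : T) :
  hausdorff_space T -> cut_point x -> exists U V, cut x U V.
Proof.
move=> hT /connectedPn[E [E0 xE sE]].
have cl b : closed (x |` E b).
  have -> : x |` E b = [set x] `|` closure (E b).
    apply/seteqP; split=> y [->|Ey]; try by left.
      by right; exact: subset_closure.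
    have [->|yx] := pselect (y = x); first by left.
    right; have : [set~ x] y by [].
    case: sE => sE1 sE2; rewrite xE; case: b Ey => Ey [] //= Ey'.
    - by case: (setI0P sE2 Ey' Ey).
    - by case: (setI0P sE1 Ey Ey').
  apply: closedU; last exact: closed_closure.
  exact/accessible_closed_set1/hausdorff_accessible.
have op b : E b = ~` (x |` E (~~ b)).
  apply/seteqP; split=> y /=.
    move=> Eby [yx|Ey].
      have : [set~ x] y by rewrite xE; case: b Eby; [right|left].
      by rewrite yx; apply.
    case: b Eby Ey => /= Ey Ey'.
      exact: setI0P (separated_disjoint sE) Ey' Ey.
    exact: setI0P (separated_disjoint sE) Ey Ey'.
  move=> /not_orP[yx nE]; have : [set~ x] y by [].
  by rewrite xE; case: b nE => /= nE [].
exists (E false), (E true); split=> //.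
- by rewrite op openC.
- by rewrite op openC.
- exact: separated_disjoint.
Qed.

(* [d |` A] is connected and misses x, so it lies on one side of the cut at x. *)
Lemma cut_nested (T : topologicalType) (x d : T) U V A B :
  connected [set: T] -> cut x U V -> cut d A B -> U d -> B x -> d |` A `<=` U.
Proof.
move=> cT cx cd Ud Bx.
have sub : d |` A `<=` U `|` V.
  rewrite (cut_cover cx) => y Wy yx; move: Bx.
  by rewrite -(cut_setC cd) -yx.
have [//|/(_ d)] :=
  connected_subset (cut_separated cx) sub (cut_connected cT cd).
by move=> Vd; case: (setI0P (cut_disjoint cx) Ud); apply: Vd; left.
Qed.

(* In a compact piece, nested smaller pieces have a common point, so Zorn's
   lemma yields a minimal piece; a cut inside it gives a smaller one. *)
Lemma cut_not_compact (T : topologicalType) (d : T) A B :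
  hausdorff_space T -> cut_point_space T -> cut d A B -> ~ compact (d |` A).
Proof.
move=> hT [cT cutT] cd cptW.
(* [U a] is the side of a cut at [a] that avoids [d]; outside [A] the value [set0] is a dummy. *)
have /choice[U HU] a : exists U, A a -> exists2 V, cut a U V & V d.
  have [Aa|nA] := pselect (A a); last by exists set0.
  have [U [V c]] := cut_of_cut_point hT (cutT a).
  have da : d <> a by move=> da; apply: (cut_neql cd); rewrite da.
  case: (cut_or c da) => ?; last by exists U => _; exists V.
  by exists V => _; exists U => //; exact: cutC.
pose W a := a |` U a.
have WA a : A a -> W a `<=` A.
  by move=> Aa; have [V c Vd] := HU a Aa; exact: (cut_nested cT cd c Aa Vd).
(* Otherwise the far side of the cut at [a], which contains [d], would be nested in [U b], although
   [d] is on the other side of the cut at [b]. *)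
have Uasym a b : A a -> A b -> U a b -> U b a -> False.
  move=> Aa Ab Uab Uba; have [V c Vd] := HU a Aa; have [V' c' Vd'] := HU b Ab.
  have /(_ d (or_intror Vd)) Ubd := cut_nested cT c' (cutC c) Uba Uab.
  exact: setI0P (cut_disjoint c') Ubd Vd'.
have Wsub a b : A a -> A b -> W a b -> W b `<=` W a.
  move=> Aa Ab [->//|Uab]; have [V c Vd] := HU a Aa.
  have [V' c' Vd'] := HU b Ab.
  have ab : a <> b by move=> ab; apply: (cut_neql c); rewrite {2}ab.
  case: (cut_or c' ab) => [/(Uasym _ _ Aa Ab Uab)//|V'a].
  by move=> y /(cut_nested cT c c' Uab V'a); right.
have [a0 Aa0] := cut_nonemptyl cd.
pose R (a b : {a | A a}) := `[< W (sval b) `<=` W (sval a) >].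
have [||S Stot|[t At] tmax] := @ZL_preorder {a | A a} (exist _ a0 Aa0) R.
- by move=> a; apply/asboolP.
- move=> b a c /asboolP ab /asboolP bc; apply/asboolP; exact: subset_trans ab.
- have [[s0 Ss0]|nS] := pselect (S !=set0); last first.
    by exists (exist _ a0 Aa0) => s Ss; case: nS; exists s.
  (* The pieces of a nonempty chain generate a filter on a compact set. They are closed, so a
     cluster point [p] lies in all of them, and [W p] bounds the chain. *)
  pose F := filter_from S (fun s => W (sval s)).
  have FF : ProperFilter F.
    apply: filter_from_proper; last by move=> s _; exists (sval s); left.
    apply: filter_from_filter; first by exists s0.
    move=> a b Sa Sb; have [/asboolP ab|/asboolP ba] := Stot a b Sa Sb.
      by exists b => // y Wy; split=> //; exact: ab.
    by exists a => // y Wy; split=> //; exact: ba.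
  have FW : F (d |` A).
    by exists s0 => // y Wy; right; apply: WA Wy; exact: (svalP s0).
  have [p [_ Fp]] := cptW F FF FW.
  have Wp s : S s -> W (sval s) p.
    move=> Ss; have [V c _] := HU _ (svalP s).
    apply: (cut_closed c) => N Np.
    by apply: Fp Np; exists s.
  have Ap : A p by apply: (WA _ (svalP s0)); exact: Wp.
  exists (exist _ p Ap) => s Ss; apply/asboolP => /=.
  by apply: Wsub; [exact: (svalP s)|exact: Ap|exact: Wp].
(* A point [b] of [U t] has its piece inside [W t]; extremality of [t] then puts [t] into [W b],
   against asymmetry. *)
- have [V c Vd] := HU t At; have [b Utb] := cut_nonemptyl c.
  have Ab : A b by apply: (WA t At); right.
  have : R (exist _ t At) (exist _ b Ab).
    by apply/asboolP => /=; apply: Wsub => //; right.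
  move=> /tmax /asboolP /= /(_ t (or_introl erefl)) [tb|Ubt].
    by apply: (cut_neql c); rewrite {2}tb.
  exact: (Uasym t b).
Qed.

Lemma separable_dense_sequence (T : topologicalType) :
  separable T -> [set: T] !=set0 ->
  exists a : nat -> T, forall O, open O -> O !=set0 -> exists n, O (a n).
Proof.
move=> [D cD dD] [p _].
have [a Da] : exists a : nat -> T, D `<=` range a.
  have [D0|[f]] := pfcard_geP cD; first by exists (fun=> p); rewrite D0.
  by exists f => y /(@surj _ _ _ _ f)[n _ <-]; exists n.
exists a => O oO O0; have [y [Oy /Da[n _ any]]] := dD O O0 oO.
by exists n; rewrite any.
Qed.

(** A side of a cut contains a point of a dense sequence, and one of the two sides at that point is
    nested in it. Both sides at every dense point therefore suffice; two further pieces, inside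
    opposite sides of one cut, provide the disjoint pair. *)
Lemma cut_family (T : topologicalType) :
  hausdorff_space T -> cut_point_space T -> separable T -> [set: T] !=set0 ->
  exists (x : nat -> T) (U V : nat -> set T),
    [/\ forall n, cut (x n) (U n) (V n),
        forall y A B, cut y A B -> exists n, x n |` U n `<=` A &
        (x 0 |` U 0) `&` (x 1 |` U 1) = set0].
Proof.
move=> hT [cT cutT] sT T0; have [p _] := T0.
have /choice[c Hc] a : exists UV : set T * set T, cut a UV.1 UV.2.
  by have [U [V ?]] := cut_of_cut_point hT (cutT a); exists (U, V).
have [e dense_e] := separable_dense_sequence sT T0.
pose side b a := if b then (c a).1 else (c a).2.
have Hs b a : cut a (side b a) (side (~~ b) a).
  by case: b => //=; apply: cutC.
have inner y A B a : cut y A B -> A a -> exists b, a |` side b a `<=` A.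
  move=> cy Aa; have ya : y <> a by move=> ya; apply: (cut_neql cy); rewrite ya.
  case: (cut_or (Hc a) ya) => [ay|ay].
    by exists false; apply: (cut_nested cT cy (Hs false a) Aa).
  by exists true; apply: (cut_nested cT cy (Hs true a) Aa).
have [u Uu] := cut_nonemptyl (Hc p); have [v Vv] := cut_nonemptyr (Hc p).
have [b Hb] := inner _ _ _ _ (Hc p) Uu.
have [b' Hb'] := inner _ _ _ _ (cutC (Hc p)) Vv.
(* Indices 0 and 1 carry the disjoint pair. Index [m.+2] carries the dense point [e m./2], with the
   side given by the parity of [m]. *)
pose x n := if n is n'.+1 then if n' is m.+1 then e m./2 else v else u.
pose s n := if n is n'.+1 then if n' is m.+1 then odd m else b' else b.
exists x, (fun n => side (s n) (x n)), (fun n => side (~~ s n) (x n)).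
split=> [n|y A B cy|]; first exact: Hs.
- have [n Az] := dense_e _ (cut_openl cy) (cut_nonemptyl cy).
  have [b'' Hb''] := inner _ _ _ _ cy Az.
  exists (b'' + n.*2).+2; rewrite /= half_bit_double oddD odd_double addbF.
  by rewrite oddb.
- apply/seteqP; split=> // z [/Hb Uz /Hb' Vz].
  exact: setI0P (cut_disjoint (Hc p)) Uz Vz.
Qed.

(** * Compactifications without cut points *)

(** Together with [compact_set_val], this passes from subsets of [T] to the subtypes in which
    [subcontinuum] is stated. *)
Lemma connected_set_val (T : topologicalType) (A : set T) (B : set A) :
  connected (set_val @` B) -> connected B.
Proof.
move=> cB D [d Dd] [O' [O oO <-] DO] [C' cC' DC].
have [O2 oO2 O2E] : open (~` C') by rewrite openC.
have DB : set_val @` D = set_val @` B.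
  apply: cB; first by exists (set_val d), d.
    exists O => //; apply/seteqP; split=> y.
      by move=> [b]; rewrite DO => -[Bb Ob] <-; split => //; exists b.
    by move=> [[b Bb <-] Ob]; exists b => //; rewrite DO.
  exists (~` O2); first by rewrite closedC.
  apply/seteqP; split=> y.
    move=> [b]; rewrite DC => -[Bb Cb] <-; split; first by exists b.
    by move=> Ob; have : (~` C') b by rewrite -O2E.
  move=> [[b Bb <-] Ob]; exists b => //; rewrite DC; split => //.
  by apply: contrapT => nC; apply: Ob; have : (~` C') b := nC; rewrite -O2E.
apply/seteqP; split=> b; first by rewrite DO => -[].
move=> Bb; have : (set_val @` D) (set_val b) by rewrite DB; exists b.
move=> [b']; rewrite DO => -[_ Ob'] bb'.
by split => //; rewrite /preimage /= -bb'.
Qed.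

Lemma compact_set_val (T : topologicalType) (A : set T) (B : set A) :
  compact (set_val @` B) -> compact B.
Proof.
move=> cB F FF FB.
have FB' : (set_val @ F) (set_val @` B).
  by apply: (@filterS _ F _ B) => // b Bb; exists b.
have [p [[b Bb bp] Fp]] := cB _ _ FB'; exists b; split => // G N FG.
rewrite nbhsE => -[N' [[O oO <-] Ob] ON].
have FG' : (set_val @ F) (set_val @` G).
  by apply: (@filterS _ F _ G) => // c Gc; exists c.
have [|_ [[c Gc <-] Oc]] := Fp _ O FG'.
  by rewrite -bp; apply: open_nbhs_nbhs.
by exists c; split => //; exact: ON.
Qed.

Lemma hausdorff_set_type (T : topologicalType) (A : set T) :
  hausdorff_space T -> hausdorff_space A.
Proof.
move=> hT p q pq; apply: val_inj; apply: hT => M N Mp Nq.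
have cv : continuous (set_val : A -> T) by exact: initial_continuous.
have [c [Mc Nc]] := pq _ _ (cv p M Mp) (cv q N Nq).
by exists (set_val c).
Qed.

Lemma set_val_preimageK (T : topologicalType) (A S : set T) :
  S `<=` A -> set_val @` (set_val @^-1` S : set A) = S.
Proof.
move=> SA; apply/seteqP; split=> y; first by move=> [b Sb <-].
by move=> Sy; exists (SigSub (mem_set (SA y Sy))).
Qed.

Lemma continuum_set_type (T : topologicalType) (A : set T) :
  hausdorff_space T -> compact A -> connected A -> continuum A.
Proof.
move=> hT cptA conA; rewrite /continuum -(preimage_setT (set_val : A -> T)).
have vT : set_val @` (set_val @^-1` A : set A) = A by exact: set_val_preimageK.
have -> : set_val @^-1` [set: T] = set_val @^-1` A :> set A.
  by apply/seteqP; split=> // a _; exact: set_valP.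
split; last exact: hausdorff_set_type.
- by apply: connected_set_val; rewrite vT.
- by apply: compact_set_val; rewrite vT.
Qed.

Lemma closed_connected_subcontinuum (T : topologicalType) (A : set T) :
  continuum T -> closed A -> connected A -> subcontinuum A.
Proof.
move=> [_ cptT hT] clA conA; apply: continuum_set_type => //.
exact: subclosed_compact clA cptT _.
Qed.

(** A separation of [B] leaves [A] in one half, whose closure contains [B] and so meets the other
    half. *)
Lemma connected_between (T : topologicalType) (A B : set T) :
  connected A -> A `<=` B -> B `<=` closure A -> connected B.
Proof.
move=> cA AB BA; apply/connectedP => E [E0 BE sE].
have AE : A `<=` E false `|` E true by rewrite -BE.
have {sE} [sE1 sE2] := sE.
have [y Ey] := E0 true; have [z Ez] := E0 false.
have By : B y by rewrite BE; right.
have Bz : B z by rewrite BE; left.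
have [/closureS AE'|/closureS AE'] := connected_subset (conj sE1 sE2) AE cA.
- exact: setI0P sE1 (AE' _ (BA _ By)) Ey.
- exact: setI0P sE2 Ez (AE' _ (BA _ Bz)).
Qed.

(** Being a homeomorphism onto the image is expressed by neighbourhoods in [Y]; [embedding_inj] gets
    injectivity from the Hausdorff property. *)
Definition embedding (X Y : topologicalType) (e : X -> Y) : Prop :=
  continuous e /\
  forall x N, nbhs x N -> exists2 M, nbhs (e x) M & e @^-1` M `<=` N.

Lemma embedding_inj (X Y : topologicalType) (e : X -> Y) :
  hausdorff_space X -> embedding e -> injective e.
Proof.
move=> hX [_ ee] x y exy; apply: hX => M N Mx Ny.
have [M' /nbhs_singleton M'x M'M] := ee x M Mx.
by exists y; split; [apply: M'M; rewrite /preimage/= -exy|exact: nbhs_singleton].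
Qed.

Lemma embedding_closure (X Y : topologicalType) (e : X -> Y) (A : set X) x :
  embedding e -> closure (e @` A) (e x) -> closure A x.
Proof.
move=> [_ ee] clx N /ee[M Mx MN].
by have [_ [[a Aa <-] Ma]] := clx M Mx; exists a; split=> //; exact: MN.
Qed.

Lemma closure_image_cut_connected (X Y : topologicalType) (e : X -> Y) x U V :
  connected [set: X] -> continuous e -> cut x U V ->
  connected (closure (e @` (x |` U))).
Proof.
move=> cX ce cx; apply: connected_closure; apply: connected_continuous_connected.
  exact: cut_connected cx.
exact: continuous_subspaceT.
Qed.

(** Removing a remainder point leaves a set between the connected [range e] and its closure. A cut
    of [Y] at [e x] pulls back to a cut of [X] at [x], so [C] meets both of its sides while missing
    [e x], against connectedness. *)
Lemma not_cut_point_compactification (X Y : topologicalType) (e : X -> Y)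
    (C : set Y) :
  hausdorff_space X -> connected [set: X] -> hausdorff_space Y ->
  embedding e -> dense (range e) ->
  connected C -> C `&` range e = set0 ->
  (forall x U V, cut x U V -> closure (e @` (x |` U)) `&` C !=set0) ->
  forall y : Y, ~ cut_point y.
Proof.
move=> hX cX hY ee de cC C0 CU y cy; have [ce _] := ee.
have [[x _ exy]|ny] := pselect (range e y); last first.
  apply: cy; apply: (@connected_between _ (range e)).
  - apply: connected_continuous_connected => //; exact: continuous_subspaceT.
  - by move=> z rz zy; apply: ny; rewrite -[y]zy.
  - move=> z _ N; rewrite nbhsE => -[O [oO Oz] ON].
    have [|w [Ow ew]] := de O _ oO; first by exists z.
    by exists w; split=> //; exact: ON.
have [S [T cST]] := cut_of_cut_point hY cy.
have cpre S' T' : cut y S' T' -> cut x (e @^-1` S') (e @^-1` T').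
  move=> c; split.
  - by apply: open_comp; [move=> ? _; exact: ce|exact: cut_openl c].
  - by apply: open_comp; [move=> ? _; exact: ce|exact: cut_openr c].
  - have [w [Sw [a _ aw]]] := de _ (cut_nonemptyl c) (cut_openl c).
    by exists a; rewrite /preimage/= aw.
  - have [w [Sw [a _ aw]]] := de _ (cut_nonemptyr c) (cut_openr c).
    by exists a; rewrite /preimage/= aw.
  - by rewrite -preimage_setI (cut_disjoint c) preimage_set0.
  - rewrite -preimage_setU (cut_cover c); apply/seteqP; split=> a /= ax.
      by move=> axE; apply: ax; rewrite axE.
    by rewrite -exy => /(embedding_inj hX ee).
have meet S' T' : cut y S' T' -> exists2 z, C z & S' z.
  move=> c; have [z [clz Cz]] := CU _ _ _ (cpre _ _ c).
  exists z => //.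
  have : (y |` S') z.
    apply: (cut_closed c); apply: closureS clz => _ [a [->|Sa] <-]; last by right.
    by left.
  move=> [zy|//]; case: (setI0P C0 Cz); rewrite zy -exy; exact: imageT.
have CST : C `<=` S `|` T.
  rewrite (cut_cover cST) => z Cz /= zy.
  by case: (setI0P C0 Cz); rewrite zy -exy; exact: imageT.
have [s Cs Ss] := meet _ _ cST; have [t Ct Tt] := meet _ _ (cutC cST).
have [/(_ _ Ct) St|/(_ _ Cs) Ts] := connected_subset (cut_separated cST) CST cC.
- exact: setI0P (cut_disjoint cST) St Tt.
- exact: setI0P (cut_disjoint cST) Ss Ts.
Qed.

Lemma reducible_compactification (X Y : topologicalType) (e : X -> Y)
    x0 U0 V0 x1 U1 V1 :
  connected [set: X] -> continuum Y -> embedding e -> dense (range e) ->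
  cut x0 U0 V0 -> cut x1 U1 V1 -> (x0 |` U0) `&` (x1 |` U1) = set0 ->
  closure (e @` (x0 |` U0)) `&` closure (e @` (x1 |` U1)) !=set0 ->
  reducible Y.
Proof.
move=> cX cY ee de c0 c1 W01 meet.
have [ce _] := ee.
pose K x U := closure (e @` (x |` U)).
have Ksub x U V z : cut x U V -> K x U (e z) -> (x |` U) z.
  by move=> c /(embedding_closure ee) clz; exact: (cut_closed c).
have Kprop x U V : cut x U V -> K x U <> setT.
  move=> c KT; have [v Vv] := cut_nonemptyr c.
  have /(Ksub _ _ _ _ c) : K x U (e v) by rewrite KT.
  by rewrite -{1}(setCK (x |` U)) (cut_setC c).
have Kcover x U V y : cut x U V -> K x U y \/ K x V y.
  move=> c; have : closure (range e) y.
    move=> N; rewrite nbhsE => -[O [oO Oy] ON].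
    have [|w [Ow ew]] := de O _ oO; first by exists y.
    by exists w; split=> //; exact: ON.
  have -> : range e = e @` (x |` U) `|` e @` (x |` V).
    rewrite -image_setU; congr (e @` _); apply/seteqP; split=> // z _.
    have [->|zx] := pselect (z = x); first by left; left.
    by case: (cut_or c zx) => ?; [left; right|right; right].
  by rewrite closureU.
have Ksc x U V : cut x U V -> subcontinuum (K x U).
  move=> c; apply: closed_connected_subcontinuum => //.
    exact: closed_closure.
  exact: closure_image_cut_connected c.
(* If [b] lies in [K x0 U0], then either [a] does too or [a] and [b] exchange roles. *)
suff main a b : ~ K x0 U0 b -> exists A : set Y,
    [/\ subcontinuum A, A <> [set: Y], A a & A b].
  move=> a b; have [Kb|nKb] := pselect (K x0 U0 b); last exact: main.
  have [Ka|nKa] := pselect (K x0 U0 a).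
    by exists (K x0 U0); split=> //; [exact: Ksc c0|exact: Kprop c0].
  by have [A [? ? ? ?]] := main b a nKa; exists A.
move=> nb; have [//|Vb] := Kcover _ _ _ b c0.
have [Va|nVa] := pselect (K x0 V0 a).
  exists (K x0 V0); split=> //; first exact: Ksc (cutC c0).
  exact: Kprop (cutC c0).
have [Ua|//] := Kcover _ _ _ a c0.
(* The second piece misses the first, so it lies in [V0] and its closure in [K x0 V0]. *)
have nU1a : ~ K x1 U1 a.
  move=> K1a; apply: nVa; apply: closureS K1a; apply: image_subset => z Wz.
  by right; rewrite -(cut_setC c0) => W0z; exact: setI0P W01 W0z Wz.
have [//|V1a] := Kcover _ _ _ a c1.
have [V1b|nV1b] := pselect (K x1 V1 b).
  exists (K x1 V1); split=> //; first exact: Ksc (cutC c1).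
  exact: Kprop (cutC c1).
have [U1b|//] := Kcover _ _ _ b c1.
exists (K x0 U0 `|` K x1 U1); split; [|..|by left|by right].
- apply: closed_connected_subcontinuum => //.
    by apply: closedU; exact: closed_closure.
  by apply: connectedU; [exact: meet|..];
    [exact: closure_image_cut_connected c0|exact: closure_image_cut_connected c1].
(* If the union were all of [Y], the two disjoint closed pieces would cover [X], and the first would
   be clopen. *)
- move=> KT.
  have WT : (x0 |` U0) = [set: X].
    apply: cX; first by exists x0; left.
      exists (x0 |` U0); rewrite ?setTI //.
      have -> : x0 |` U0 = ~` (x1 |` U1); last first.
        by rewrite openC; exact: cut_closed c1.
      apply/seteqP; split=> z; first by move=> ? ?; apply: (setI0P W01); eassumption.
      move=> nW1; have : (K x0 U0 `|` K x1 U1) (e z) by rewrite KT.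
      by move=> [/(Ksub _ _ _ _ c0)//|/(Ksub _ _ _ _ c1)].
    by exists (x0 |` U0); rewrite ?setTI //; exact: cut_closed c0.
  have : (x0 |` U0) x1 by rewrite WT.
  by move=> W0; apply: (setI0P W01 W0); left.
Qed.

Local Open Scope ring_scope.

(** * The Hilbert cube *)

(** A copy of the function type, free to carry its own metric. Coordinates are unbounded; the
    Hilbert cube proper is the set in [cube_compact]. *)
Definition cube (R : realType) (I : countType) : Type := I -> R.

HB.instance Definition _ (R : realType) (I : countType) :=
  Choice.copy (cube R I) (I -> R).

Definition cube_weight (R : realType) (I : countType) (i : I) : R :=
  (pickle i).+1%:R^-1.

Lemma cube_weight_gt0 (R : realType) (I : countType) (i : I) :
  0 < cube_weight R i.
Proof. by rewrite invr_gt0 ltr0n. Qed.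

Lemma cube_weight_le1 (R : realType) (I : countType) (i : I) :
  cube_weight R i <= 1.
Proof. by rewrite invf_le1 ?ltr0n // ler1n. Qed.

(** Truncating each gap at a weight that tends to 0 makes the supremum metrize the product topology.
    The extra 0 covers an empty [I]. *)
Definition cube_gaps (R : realType) (I : countType) (p q : cube R I) : set R :=
  0 |` range (fun i => Num.min `|p i - q i| (cube_weight R i)).

Definition cube_dist (R : realType) (I : countType) (p q : cube R I) : R :=
  sup (cube_gaps p q).

Lemma cube_gaps_sup (R : realType) (I : countType) (p q : cube R I) :
  has_sup (cube_gaps p q).
Proof.
split; first by exists 0; left.
exists 1 => _ [->|[i _ <-]]; first exact: ler01.
by rewrite ge_min cube_weight_le1 orbT.
Qed.

Lemma cube_dist_le (R : realType) (I : countType) (p q : cube R I) e :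
  0 <= e -> (forall i, Num.min `|p i - q i| (cube_weight R i) <= e) ->
  cube_dist p q <= e.
Proof.
move=> e0 H; apply: ge_sup; first by exists 0; left.
by move=> _ [->|[i _ <-]].
Qed.

Lemma cube_dist_ge (R : realType) (I : countType) (p q : cube R I) i :
  Num.min `|p i - q i| (cube_weight R i) <= cube_dist p q.
Proof. by apply: (ub_le_sup (proj2 (cube_gaps_sup p q))); right; exists i. Qed.

Lemma cube_dist_ge0 (R : realType) (I : countType) (p q : cube R I) :
  0 <= cube_dist p q.
Proof. by apply: (ub_le_sup (proj2 (cube_gaps_sup p q))); left. Qed.

Lemma cube_distxx (R : realType) (I : countType) (p : cube R I) :
  cube_dist p p = 0.
Proof.
apply/eqP; rewrite eq_le cube_dist_ge0 andbT; apply: cube_dist_le => // i.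
by rewrite subrr normr0 ge_min lexx.
Qed.

Lemma cube_dist_eq0 (R : realType) (I : countType) (p q : cube R I) :
  cube_dist p q = 0 -> p = q.
Proof.
move=> pq; apply/funext => i; apply/eqP; rewrite -subr_eq0 -normr_le0.
have := cube_dist_ge p q i; rewrite pq ge_min => /orP[//|].
by rewrite leNgt cube_weight_gt0.
Qed.

Lemma cube_dist_sym (R : realType) (I : countType) (p q : cube R I) :
  cube_dist p q = cube_dist q p.
Proof.
rewrite /cube_dist /cube_gaps.
by under [in LHS]eq_fun do rewrite distrC.
Qed.

Lemma cube_dist_triangle (R : realType) (I : countType) (q p r : cube R I) :
  cube_dist p r <= cube_dist p q + cube_dist q r.
Proof.
apply: cube_dist_le => [|i]; first by rewrite addr_ge0 ?cube_dist_ge0.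
apply: (le_trans _ (lerD (cube_dist_ge p q i) (cube_dist_ge q r i))).
have := ler_distD (q i) (p i) (r i).
have := cube_weight_gt0 R i; set w := cube_weight R i.
have := normr_ge0 (p i - q i); have := normr_ge0 (q i - r i).
by rewrite /Num.min; do 3 case: ifP; lra.
Qed.

HB.instance Definition _ (R : realType) (I : countType) :=
  isMetric.Build R (cube R I) (@cube_distxx R I) (@cube_dist_eq0 R I)
    (@cube_dist_sym R I) (@cube_dist_triangle R I).

Lemma cube_coord_continuous (R : realType) (I : countType) (i : I) :
  continuous (fun p : cube R I => p i).
Proof.
move=> p A /nbhs_ballP[e /= e0 eA].
have w0 := cube_weight_gt0 R i.
apply/nbhs_ballP; exists (Num.min e (cube_weight R i)) => /=.
  by rewrite lt_min e0.
move=> q; rewrite ballEmdist /= lt_min => /andP[pqe pqw].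
apply: eA; rewrite /ball /=.
have := le_lt_trans (cube_dist_ge p q i) pqe.
have := le_lt_trans (cube_dist_ge p q i) pqw.
by rewrite !gt_min ltxx orbF => wlt /orP[//|]; lra.
Qed.

Lemma near_all_ltn (X : Type) (F : set_system X) (P : nat -> X -> Prop) N :
  Filter F -> (forall n, \forall x \near F, P n x) ->
  \forall x \near F, forall n, (n < N)%N -> P n x.
Proof.
move=> FF HP; elim: N => [|N IH]; first exact: nearW.
near=> x => n; rewrite ltnS leq_eqVlt => /orP[/eqP ->|]; first by near: x.
by move: n; near: x.
Unshelve. all: by end_near. Qed.

(** All but finitely many coordinates have weight at most [e / 2], so only finitely many need
    control. *)
Lemma cube_continuous_at (R : realType) (I : countType) (X : topologicalType)
    (f : X -> cube R I) (x : X) :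
  (forall i, (fun y => f y i) @ x --> f x i) -> f @ x --> f x.
Proof.
move=> cf A /nbhs_ballP[e /= e0 eA].
pose P n y := forall i : I, pickle i = n -> `|f x i - f y i| <= e / 2.
have HP n : \forall y \near x, P n y.
  have [[i <-]|ni] := pselect (exists i : I, pickle i = n); last first.
    by apply: nearW => y i iE; case: ni; exists i.
  have /cvgrPdist_le/(_ (e / 2)) : (fun y => f y i) @ x --> f x i by exact: cf.
  rewrite divr_gt0 // => /(_ isT); apply: filterS => y fxy j ij.
  by rewrite (pcan_inj pickleK ij).
have [N HN] : exists N : nat, forall n, (N <= n)%N -> n.+1%:R^-1 <= e / 2.
  exists (Num.bound (e / 2)^-1) => n Nn.
  rewrite -[leRHS]invrK lef_pV2 ?posrE ?invr_gt0 ?ltr0n ?divr_gt0 //.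
  have /archi_boundP : 0 <= (e / 2)^-1 by rewrite invr_ge0 divr_ge0 // ltW.
  move=> /ltW/le_trans; apply; rewrite ler_nat; exact: leqW.
suff : nbhs x (f @^-1` A) by [].
have := near_all_ltn N (nbhs_filter x) HP; apply: filterS => y Py; apply: eA.
rewrite ballEmdist /= (@le_lt_trans _ _ (e / 2)) //; last by lra.
apply: cube_dist_le => [|i]; first by rewrite divr_ge0 // ltW.
rewrite ge_min; have [iN|Ni] := ltnP (pickle i) N.
  by rewrite (Py _ iN).
by rewrite [X in _ || X]HN // orbT.
Qed.

Lemma cube_continuous (R : realType) (I : countType) (X : topologicalType)
    (f : X -> cube R I) :
  (forall i, continuous (fun x => f x i)) -> continuous f.
Proof. by move=> cf x; apply: cube_continuous_at => i; exact: cf. Qed.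

(** Tychonoff's theorem applies to the product topology, from which the identity map to the metric
    topology is continuous. *)
Lemma cube_compact (R : realType) (I : countType) :
  compact [set p : cube R I | forall i, `|p i| <= 1].
Proof.
pose K : set (prod_topology (fun _ : I => R)) := [set p | forall i, `[-1, 1]%classic (p i)].
have cK : compact K.
  exact: (@tychonoff I (fun=> R) (fun=> `[-1, 1]%classic) (fun=> @segment_compact _ _ _)).
pose f : prod_topology (fun _ : I => R) -> cube R I := id.
have cf : continuous f.
  by apply: cube_continuous => i; exact: (@proj_continuous I (fun=> R) i).
rewrite (_ : [set p | _] = f @` K).
  by apply: continuous_compact cK; exact: continuous_subspaceT.
apply/seteqP; split=> p /=.
  by move=> pI; exists p => // i; rewrite /= in_itv /= -ler_norml.
by move=> [q Kq <-] i; have := Kq i; rewrite /= in_itv /= -ler_norml.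
Qed.

Lemma cube_embedding (R : realType) (I : countType) (X : topologicalType)
    (f : X -> cube R I) :
  (forall i, continuous (fun x => f x i)) ->
  (forall x N, nbhs x N -> exists i, exists2 e, 0 < e &
     forall y, `|f x i - f y i| < e -> N y) ->
  embedding f.
Proof.
move=> cf Hf; split; first exact: cube_continuous.
move=> x N /Hf[i [e e0 eN]]; exists [set p | `|f x i - p i| < e]; last exact: eN.
exact: (@cube_coord_continuous R I i (f x) _ (nbhsx_ballx _ _ e0)).
Qed.

Lemma separable_metrizable_embedding (R : realType) (X : topologicalType) :
  [set: X] !=set0 -> separable X -> metrizable R X ->
  exists2 f : X -> cube R nat, embedding f & forall x i, `|f x i| <= 1.
Proof.
move=> X0 sX [M [g [g' [gK gK' cg cg']]]].
have [a dense_a] := separable_dense_sequence sX X0.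
(* Distances to a dense sequence, truncated at 1 to land in the compact cube. *)
pose f x : cube R nat := fun k => Num.min (mdist (g x) (g (a k))) 1.
exists f; last first.
  move=> x i; rewrite ger0_norm ?le_min ?mdist_ge0 ?ler01 //.
  by rewrite ge_min lexx orbT.
apply: cube_embedding => [i x A /nbhs_ballP[e /= e0 eA]|x N xN].
  have : nbhs x (g @^-1` ball (g x) e) := cg x _ (nbhsx_ballx _ _ e0).
  apply: filterS => y; rewrite /preimage /=.
  rewrite ballEmdist /= => xy; apply: eA; rewrite /ball /= /f.
  have := metric_triangle (g y) (g x) (g (a i)).
  have := metric_triangle (g x) (g y) (g (a i)).
  rewrite (metric_sym (g y) (g x)).
  by rewrite /Num.min ltr_norml; do 2 case: ifP; lra.
have : nbhs (g x) (g' @^-1` N) by apply: cg'; rewrite gK.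
move=> /nbhs_ballP[e /= e0 eN].
(* For [a i] within [d] of [x], a nearby coordinate of [y] is below [2 * d < 1], hence a true
   distance, and [x], [y] are less than [3 * d <= e] apart. *)
pose d := Num.min e 1 / 3.
have d0 : 0 < d by rewrite divr_gt0 // lt_min e0 ltr01.
have [i xz] : exists i, (g @^-1` interior (ball (g x) d)) (a i).
  apply: dense_a; last by exists x; exact: nbhsx_ballx.
  by apply: open_comp => [? _|]; [exact: cg|exact: open_interior].
exists i, d => // y; rewrite /f => fxy.
suff /eN : ball (g x) e (g y) by rewrite /preimage /= gK.
have {xz} := interior_subset xz; rewrite !ballEmdist /= => xz.
have := metric_triangle (g x) (g (a i)) (g y); rewrite (metric_sym (g (a i)) (g y)).
move: fxy xz d0; rewrite ltr_norml /d /Num.min.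
by case: (ltP e 1); case: (ltP (mdist (g x) (g (a i))) 1);
  case: (ltP (mdist (g y) (g (a i))) 1) => ? ? ? /andP[]; lra.
Qed.

(** * Functions invariant under a gluing map *)

Lemma finite_set_isolated (R : realType) (T : metricType R) (F : set T) (p : T) :
  finite_set F ->
  exists2 e : R, 0 < e & forall q, F q -> mdist p q < e -> q = p.
Proof.
move=> finF.
have cF : closed (F `\ p).
  apply: compact_closed; first exact: metric_hausdorff.
  exact/finite_compact/finite_setD.
have /nbhs_ballP[e e0 eF] : nbhs p (~` (F `\ p)).
  by apply: open_nbhs_nbhs; split; [rewrite openC|move=> -[_]; apply].
exists e => // q Fq pqe; apply: contrapT => qp.
by apply: (eF q); [rewrite ballEmdist|split].
Qed.

(** This is upper semicontinuity of the decomposition into fibres of [h]. Let [p'] in the saturation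
    be close to [p], with partner [q] in [A]. Then [p'] moves little, so [h q = h p'] is near [p].
    Either [q] also moves little and is near [p], or [h q] is one of finitely many points and must
    equal [p]. *)
Lemma closed_saturation (R : realType) (T : metricType R) (h : T -> T)
    (A : set T) :
  (forall p, h (h p) = h p) ->
  (forall e, 0 < e -> finite_set [set p | e <= mdist p (h p)]) ->
  closed A -> closed (h @^-1` (h @` A)).
Proof.
move=> hh finh cA p clp; apply: contrapT => nSp.
have nAp : ~ A p by move=> Ap; apply: nSp; exists p.
have /nbhs_ballP[e3 /= e30 e3A] : nbhs p (~` A).
  by apply: open_nbhs_nbhs; split; rewrite ?openC.
(* The path from [p] to [q] costs less than [d + d] up to [h p'] and less than [e] from there, with
   [d <= e]. *)
pose e := e3 / 3.
have e0 : 0 < e by rewrite divr_gt0.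
have [d1 d10 Hd1] := @finite_set_isolated R T _ p (finite_image h (finh e e0)).
pose d := Num.min e (d1 / 2).
have d0 : 0 < d by rewrite lt_min e0 divr_gt0.
have [d2 d20 Hd2] := @finite_set_isolated R T _ p (finh d d0).
have [p' [[q Aq hqp'] pp']] := clp _ (nbhsx_ballx p (Num.min d d2) ltac:(by rewrite lt_min d0)).
have {pp'} : mdist p p' < Num.min d d2 by move: pp'; rewrite ballEmdist.
rewrite lt_min => /andP[pp'd pp'd2].
have p'p : p' <> p by move=> p'p; apply: nSp; rewrite -p'p; exists q.
have hp'd : mdist p' (h p') < d.
  by rewrite ltNge; apply/negP => hp'; apply: p'p; exact: Hd2.
have phd : mdist p (h p') < d + d.
  by apply: le_lt_trans (metric_triangle p p' (h p')) _; exact: ltrD.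
have hqe : mdist q (h q) < e.
  rewrite ltNge; apply/negP => hq; apply: nSp; exists q => //.
  have hqp : h q = p.
    apply: Hd1; first by exists q.
    rewrite hqp'; apply: lt_le_trans phd _.
    have : d <= d1 / 2 by rewrite ge_min lexx orbT.
    by lra.
  by rewrite -[in RHS]hqp hh.
apply: (e3A q) => //; rewrite ballEmdist /=.
have := metric_triangle p (h p') q; rewrite -hqp' (metric_sym (h q)) in phd *.
have : d <= e by rewrite ge_min lexx.
by move: hqe phd; rewrite /e; lra.
Qed.

(* Continuous functions on this (usually not Hausdorff) space are exactly the
   continuous functions f on T with f \o h = f. *)
Definition collapsed (T : Type) (h : T -> T) : Type := T.

Definition collapsed_open (T : topologicalType) (h : T -> T) :
  set_system (collapsed h) := [set O : set T | open O /\ h @^-1` O = O].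

Lemma collapsed_openT (T : topologicalType) (h : T -> T) :
  @collapsed_open T h setT.
Proof. by split; [exact: openT|rewrite preimage_setT]. Qed.

Lemma collapsed_openI (T : topologicalType) (h : T -> T) :
  setI_closed (@collapsed_open T h).
Proof.
move=> A B [oA hA] [oB hB]; split; first exact: openI.
by rewrite preimage_setI hA hB.
Qed.

Lemma collapsed_open_bigU (T : topologicalType) (h : T -> T) (I : Type)
    (f : I -> set (collapsed h)) :
  (forall i, @collapsed_open T h (f i)) ->
  @collapsed_open T h (\bigcup_i f i).
Proof.
move=> of_; split; first by apply: bigcup_open => i _; have [] := of_ i.
rewrite preimage_bigcup; apply: eq_bigcupr => i _; by have [] := of_ i.
Qed.

HB.instance Definition _ (T : topologicalType) (h : T -> T) :=
  Choice.copy (collapsed h) T.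
HB.instance Definition _ (T : topologicalType) (h : T -> T) :=
  isOpenTopological.Build (collapsed h) (@collapsed_openT T h)
    (@collapsed_openI T h) (@collapsed_open_bigU T h).

Lemma collapsed_closed (T : topologicalType) (h : T -> T) (A : set T) :
  closed (A : set (collapsed h)) <-> closed A /\ h @^-1` A = A.
Proof.
rewrite -openC -(openC A); split=> -[oA hA]; split=> //.
  by apply: (can_inj (@setCK T)); rewrite -[RHS]hA.
by rewrite -[in RHS]hA.
Qed.

(** Disjoint open sets of [T] are shrunk to the unions [sharp] of the fibres they contain, which are
    open by [closed_saturation]. *)
Lemma collapsed_normal (R : realType) (T : metricType R) (h : T -> T) :
  (forall p, h (h p) = h p) ->
  (forall e, 0 < e -> finite_set [set p | e <= mdist p (h p)]) ->
  normal_space (collapsed h).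
Proof.
move=> hh finh; apply/(@normal_openP R) => A B.
move=> /collapsed_closed[cA hA] /collapsed_closed[cB hB] AB0.
have /(@normal_openP R)/(_ A B cA cB AB0) := @pseudometric_normal R T.
move=> [U [V [oU oV AU BV UV0]]].
pose sharp O : set T := ~` (h @^-1` (h @` ~` O)).
have sharp_open O : open O -> open (sharp O : set (collapsed h)).
  move=> oO; split; first by rewrite openC; apply: closed_saturation; rewrite ?closedC.
  by apply/seteqP; split=> p; rewrite /sharp /preimage /= hh.
have sharp_sub O : sharp O `<=` O.
  by move=> p np; apply: contrapT => nO; apply: np; exists p.
have sub_sharp D O : h @^-1` D = D -> D `<=` O -> D `<=` sharp O.
  move=> hD DO p Dp [q nOq hqp]; apply: nOq; apply: DO.
  by rewrite -hD /preimage /= hqp -[D _]/((h @^-1` D) p) hD.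
exists (sharp U), (sharp V); split.
- exact: sharp_open.
- exact: sharp_open.
- exact: sub_sharp.
- exact: sub_sharp.
- by apply/seteqP; split=> // p [/sharp_sub Up /sharp_sub]; exact: setI0P UV0 Up.
Qed.

(** Urysohn's lemma in [collapsed h]: the fibre of [x] is a single point, so it is closed there and
    disjoint from the saturation of the complement of [interior N]. *)
Lemma invariant_urysohn (R : realType) (T : metricType R) (h : T -> T) (x : T)
    (N : set T) :
  (forall p, h (h p) = h p) ->
  (forall e, 0 < e -> finite_set [set p | e <= mdist p (h p)]) ->
  h @^-1` [set x] = [set x] -> nbhs x N ->
  exists f : T -> R, [/\ continuous f, forall p, f (h p) = f p,
    forall p, `|f p| <= 1, f x = 0 & forall p, ~ N p -> f p = 1].
Proof.
move=> hh finh hx xN.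
have hxx : h x = x by have : (h @^-1` [set x]) x by rewrite hx.
pose B := h @^-1` (h @` ~` interior N).
have cB : closed (B : set (collapsed h)).
  apply/collapsed_closed; split.
    by apply: closed_saturation; rewrite ?closedC //; exact: open_interior.
  by apply/seteqP; split=> p; rewrite /B /preimage /= hh.
have cx : closed ([set x] : set (collapsed h)).
  apply/collapsed_closed; split=> //.
  exact/accessible_closed_set1/hausdorff_accessible/metric_hausdorff.
have xB0 : [set x] `&` B = set0.
  apply/seteqP; split=> // _ [-> [q nNq]]; rewrite hxx => hqx.
  have : (h @^-1` [set x]) q by [].
  by rewrite hx => qx; apply: nNq; rewrite qx.
have := collapsed_normal hh finh.
move=> /(@normal_separatorP R)/(_ _ _ cx cB xB0)/(@uniform_separatorP _ R).
move=> [f [cf f01 f0 f1]].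
have fopen O : open O -> open (f @^-1` O : set T) /\ h @^-1` (f @^-1` O) = f @^-1` O.
  move=> oO; have : open (f @^-1` O : set (collapsed h)); last by [].
  by apply: open_comp => // ? _; exact: cf.
exists f; split.
- by apply/continuousP => O /fopen[].
- move=> p; apply: contrapT => fp.
  have [|_ E] := fopen (~` [set f (h p)]).
    rewrite openC; exact/accessible_closed_set1/hausdorff_accessible/Rhausdorff.
  have : (f @^-1` (~` [set f (h p)])) p by move=> /= fE; apply: fp.
  by rewrite -E /preimage /=; apply.
- move=> p; have : range f (f p) by exists p.
  by move=> /f01; rewrite /= in_itv /= => /andP[? ?]; rewrite ger0_norm.
- by apply: f0; exists x.
- move=> p nNp; apply: f1; exists p => //; exists p => // /interior_subset.
  exact: nNp.
Qed.

(** * Blowing up remainder points to arcs *)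

Lemma mdist_continuous (R : realType) (T : metricType R) (c : T) :
  continuous (fun p => mdist p c).
Proof.
move=> p A /nbhs_ballP[e /= e0 eA].
apply/nbhs_ballP; exists e => // q; rewrite ballEmdist /= => pqe.
apply: eA; rewrite /ball /= ltr_norml.
have := metric_triangle q p c; have := metric_triangle p q c.
by rewrite (metric_sym q p); lra.
Qed.

(** If the closure of the image of [W], compact inside [K], stayed in [range e], the cluster points
    of filters on [W] would pull back to [W]. *)
Lemma remainder_point (X Y : topologicalType) (e : X -> Y) (K : set Y)
    (W : set X) :
  hausdorff_space Y -> embedding e -> compact K -> range e `<=` K ->
  closed W -> ~ compact W -> exists2 r, closure (e @` W) r & ~ range e r.
Proof.
move=> hY [ce ee] cK eK cW; apply: contra_notP => nex F FF FW.
have cK' := compact_closed hY cK.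
have cptW : compact (closure (e @` W)).
  apply: subclosed_compact cK _; first exact: closed_closure.
  rewrite (iffLR (closure_id _) cK'); apply: closureS.
  by apply: subset_trans eK; exact: image_subset.
have FW' : (e @ F) (closure (e @` W)).
  by apply: (@filterS _ F _ W) => // x Wx; apply: subset_closure; exists x.
have [p [Wp Fp]] := cptW _ _ FW'.
have [[x _ xp]|np] := pselect (range e p); last by case: nex; exists p.
have Fx : cluster F x.
  move=> G N FG /ee[M]; rewrite xp => Mp MN.
  have FG' : (e @ F) (e @` G).
    by apply: (@filterS _ F _ G) => // z Gz; exists z.
  have [_ [[z Gz <-] Mz]] := Fp _ M FG' Mp.
  by exists z; split => //; exact: MN.
by exists x; split => //; apply: cW => N xN; exact: Fx.
Qed.

Lemma embedding_factor (X Y Z : topologicalType) (f : X -> Y) (g : Y -> Z) :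
  continuous f -> continuous g -> embedding (g \o f) -> embedding f.
Proof.
move=> cf cg [_ egf]; split=> // x N /egf[M Mx MN].
by exists (g @^-1` M); [exact: cg|exact: MN].
Qed.

Section arcs.
Context (R : realType) (X : topologicalType) (f : X -> cube R nat).
Context (r : nat -> cube R nat).

(** The oscillation of the topologist's sine curve as [p] tends to [q]. *)
Definition wave (p q : cube R nat) : R := cos (mdist p q)^-1.

Definition wave_embedding (x : X) : cube R (nat + nat)%type := fun k =>
  match k with inl i => f x i | inr k => wave (f x) (r k) end.

(* As x tends to [r n] along a connected set, the coordinate [wave _ (r n)]
   sweeps [-1, 1] while the others converge; repetitions of [r n] move along. *)
Definition wave_arc (n : nat) (s : R) : cube R (nat + nat)%type := fun k =>
  match k with
  | inl i => r n i
  | inr k => if `[< r k = r n >] then s else wave (r n) (r k)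
  end.

Hypothesis f_embedding : embedding f.
Hypothesis r_notin : forall n, ~ range f (r n).

Lemma wave_continuous (p q : cube R nat) : p <> q ->
  (fun p => wave p q) @ p --> wave p q.
Proof.
move=> pq; apply: (@continuous_comp _ _ _ (fun p => (mdist p q)^-1) cos p).
  apply: (@cvgV _ _ (nbhs p) (nbhs_filter p)); last exact: mdist_continuous.
  by apply/eqP => /mdist_positivity.
exact: continuous_cos.
Qed.

Lemma wave_embeddingP : embedding wave_embedding.
Proof.
have [cf _] := f_embedding.
(* Forgetting the wave coordinates recovers [f], which is already an embedding. *)
pose g (p : cube R (nat + nat)%type) : cube R nat := fun i => p (inl i).
apply: (@embedding_factor X (cube R (nat + nat)%type) (cube R nat) wave_embedding g).
- apply: cube_continuous => -[i|k] /= x.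
    exact: (continuous_comp (@cf x) (@cube_coord_continuous R nat i (f x))).
  apply: (@continuous_comp _ _ _ f (fun p => wave p (r k)) x (cf x)).
  apply: wave_continuous => fxr.
  by apply: (r_notin (n := k)); exists x.
- by apply: cube_continuous => i; exact: cube_coord_continuous.
- exact: f_embedding.
Qed.

Lemma wave_embedding_le1 : (forall x i, `|f x i| <= 1) ->
  forall x k, `|wave_embedding x k| <= 1.
Proof. by move=> f1 x [i|k] /=; [exact: f1|exact: cos_max]. Qed.

Lemma wave_arc_continuous n : continuous (wave_arc n).
Proof.
apply: cube_continuous => -[i|k] s /=; first exact: cvg_cst.
by case: asboolP => _; [exact: cvg_id|exact: cvg_cst].
Qed.

Lemma wave_arc_inj n m s t : wave_arc n s = wave_arc m t -> r n = r m /\ s = t.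
Proof.
move=> st; have rr : r n = r m.
  by apply/funext => i; have /= := congr1 (fun p => p (inl i)) st.
split => //; have /= := congr1 (fun p => p (inr n)) st.
by rewrite rr !asboolT.
Qed.

Lemma wave_arc_notin n s : ~ range wave_embedding (wave_arc n s).
Proof.
move=> [x _ xs]; apply: (r_notin (n := n)); exists x => //.
by apply/funext => i; have /= := congr1 (fun p => p (inl i)) xs.
Qed.

Lemma wave_arc_eq n m : r n = r m -> wave_arc n = wave_arc m.
Proof. by rewrite /wave_arc => ->. Qed.

Lemma cos_large_preimage (s b : R) : -1 <= s <= 1 ->
  exists2 t, b < t & cos t = s.
Proof.
move=> s1; exists (acos s + pi *+ 2 *+ Num.bound `|b|).
  have pi4 : 1 <= pi *+ 2 :> R.
    by rewrite mulr2n; have := pi_ge2 R; lra.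
  apply: le_lt_trans (ler_norm b) _.
  apply: lt_le_trans (archi_boundP (normr_ge0 b)) _.
  rewrite -[leLHS]add0r lerD ?acos_ge0 //.
  by rewrite -[leRHS]mulr_natr ler_peMl ?ler0n.
elim: (Num.bound _) => [|N IH]; first by rewrite mulr0n addr0 acosK.
by rewrite mulrSr addrA cosD2pi.
Qed.

(** [J] is continuous at [r n], where its value is the arc point, and agrees with [wave_embedding]
    wherever the oscillating coordinate equals [s]. On the connected [W] the distance to [r n] takes
    all small positive values, among them some [t^-1] with [cos t = s]. *)
Lemma wave_arc_closure n (W : set X) s :
  connected W -> W !=set0 -> closure (f @` W) (r n) -> -1 <= s <= 1 ->
  closure (wave_embedding @` W) (wave_arc n s).
Proof.
move=> cW [w Ww] Wr s1 N Ns.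
have [cf _] := f_embedding.
pose J (p : cube R nat) : cube R (nat + nat)%type := fun k =>
  match k with
  | inl i => p i
  | inr k => if `[< r k = r n >] then s else wave p (r k)
  end.
have cJ : J @ r n --> J (r n).
  apply: cube_continuous_at => -[i|k] /=; first exact: cube_coord_continuous.
  by case: asboolP => rkn; [exact: cst_continuous|apply: wave_continuous => /esym].
have /nbhs_ballP[e /= e0 eN] := cJ _ Ns.
pose g x := mdist (f x) (r n).
have g0 x : 0 < g x.
  rewrite mdist_gt0; apply/eqP => fxr; apply: (r_notin (n := n)).
  by exists x.
have cg : connected (g @` W).
  apply: connected_continuous_connected => //; apply: continuous_subspaceT => x.
  exact: (continuous_comp (@cf x) (@mdist_continuous R _ (r n) (f x))).
have [t tb cost] := cos_large_preimage (Num.min e (g w))^-1 s1.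
have m0 : 0 < Num.min e (g w) by rewrite lt_min e0 g0.
have t0 : 0 < t by apply: lt_trans tb; rewrite invr_gt0.
have tm : t^-1 < Num.min e (g w) by rewrite -[ltRHS]invrK ltf_pV2 ?posrE ?invr_gt0.
have [x Wx gxt] : (g @` W) t^-1.
  have [q [[v Wv vq] qt]] : (f @` W) `&` ball (r n) t^-1 !=set0.
    apply: Wr; apply: nbhsx_ballx; rewrite invr_gt0; exact: t0.
  move/connected_intervalP : cg => /(_ (g v) (g w)); apply; [by exists v|by exists w|].
  move: qt; rewrite -vq ballEmdist /= => qt.
  rewrite /g metric_sym ltW //= ltW //; apply: lt_le_trans tm _.
  by rewrite ge_min lexx orbT.
exists (wave_embedding x); split; first by exists x.
have -> : wave_embedding x = J (f x).
  apply/funext => -[i|k] //=; case: asboolP => // ->.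
  by rewrite /wave -/(g x) gxt invrK.
apply: eN; rewrite ballEmdist /= metric_sym -/(g x) gxt.
by apply: lt_le_trans tm _; rewrite ge_min lexx.
Qed.

End arcs.

(** * Linking the arcs *)

Lemma injective_nat_unbounded (f : nat -> nat) (N : nat) :
  injective f -> exists K, forall k, (K <= k)%N -> (N <= f k)%N.
Proof.
move=> injf; elim: N => [|N [K HK]]; first by exists 0%N.
have [[k0 fk0]|nk] := pselect (exists k, f k = N); last first.
  exists K => k /HK; rewrite leq_eqVlt => /orP[/eqP fk|//].
  by case: nk; exists k.
exists (maxn K k0.+1) => k; rewrite geq_max => /andP[/HK Nk k0k].
rewrite ltn_neqAle Nk andbT; apply/eqP => Nfk.
by move: k0k; rewrite (injf k k0) ?ltnn // fk0.
Qed.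

(** Otherwise infinitely many terms would keep distance [e] from all earlier ones, yet two of them
    lie within [e / 2] of a common cluster point. *)
Lemma compact_recurrent (R : realType) (T : metricType R) (K : set T)
    (y : nat -> T) (P : nat -> Prop) (e : R) :
  compact K -> (forall n, K (y n)) -> 0 < e ->
  exists N, forall n, (N <= n)%N -> P n ->
    exists k, [/\ (k < n)%N, P k & mdist (y n) (y k) < e].
Proof.
move=> cK Ky e0.
pose S n := P n /\ forall k, (k < n)%N -> P k -> e <= mdist (y n) (y k).
suff [N HN] : exists N, forall n, (N <= n)%N -> ~ S n.
  exists N => n Nn Pn; apply: contrapT => nk; apply: (HN n Nn); split => // k kn Pk.
  by rewrite leNgt; apply/negP => yy; apply: nk; exists k.
apply: contrapT => nN.
have HS N : exists2 n, (N <= n)%N & S n.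
  by apply: contrapT => nS; apply: nN; exists N => n Nn Sn; apply: nS; exists n.
pose F := filter_from [set: nat] (fun N => y @` [set n | (N <= n)%N /\ S n]).
have FF : ProperFilter F.
  apply: filter_from_proper; last first.
    by move=> N _; have [n Nn Sn] := HS N; exists (y n), n.
  apply: filter_from_filter; first by exists 0%N.
  move=> i j _ _; exists (maxn i j) => //= _ [n [+ Sn] <-].
  by rewrite geq_max => /andP[? ?]; split; exists n.
have FK : F K by exists 0%N => // _ [n _ <-]; exact: Ky.
have [p [_ Fp]] := cK F FF FK.
have e20 : 0 < e / 2 by rewrite divr_gt0.
have near_p N : exists n, [/\ (N <= n)%N, S n & mdist p (y n) < e / 2].
  have FN : F (y @` [set n | (N <= n)%N /\ S n]) by exists N.
  have [q [[n [Nn Sn] ynq] pq]] := Fp _ _ FN (nbhsx_ballx p _ e20).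
  by move: pq; rewrite -ynq ballEmdist => pq; exists n.
have [k [_ [Pk _] pk]] := near_p 0%N.
have [n [kn [_ Hn] pn]] := near_p k.+1.
have := Hn k kn Pk; have := metric_triangle (y n) p (y k).
by rewrite (metric_sym (y n) p); lra.
Qed.

Lemma exists_argmin_nat (R : realType) (P : nat -> Prop) (g : nat -> R) n k0 :
  (k0 < n)%N -> P k0 ->
  exists m, [/\ (m < n)%N, P m & forall k, (k < n)%N -> P k -> g m <= g k].
Proof.
move=> k0n Pk0.
have Pk0' : `[< P (Ordinal k0n : 'I_n) >] by apply/asboolP.
case: (@Order.TotalTheory.arg_minP _ _ _ (Ordinal k0n) (fun i : 'I_n => `[< P i >])
  (fun i : 'I_n => g i) Pk0') => m /asboolP Pm Hm.
by exists m; split => // k kn Pk; apply: (Hm (Ordinal kn)); apply/asboolP.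
Qed.

(* [h] identifies each [z n] with the nearest earlier [y m]; by compactness
   these distances tend to 0. *)
Lemma linking_map (R : realType) (T : metricType R) (K : set T)
    (y z : nat -> T) (P : nat -> Prop) :
  compact K -> (forall n, K (y n)) -> P 0%N ->
  (forall n k, y n <> z k) ->
  (forall n k, P n -> P k -> z n = z k -> n = k) ->
  (forall e, 0 < e -> exists N, forall n, (N <= n)%N -> P n ->
     mdist (z n) (y n) < e) ->
  exists h : T -> T,
    [/\ forall p, h (h p) = h p,
        forall e, 0 < e -> finite_set [set p | e <= mdist p (h p)],
        forall n, P n -> (0 < n)%N ->
          exists m, [/\ (m < n)%N, P m & h (z n) = y m] &
        forall x, (forall n, x <> y n) -> (forall n, x <> z n) ->
          h @^-1` [set x] = [set x]].
Proof.
move=> cK Ky P0 yz zinj zy.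
have /choice[m Hm] n : exists m, (0 < n)%N -> [/\ (m < n)%N, P m &
    forall k, (k < n)%N -> P k -> mdist (y n) (y m) <= mdist (y n) (y k)].
  have [n0|_] := ltnP 0 n; last by exists 0%N.
  have [m Hm] := exists_argmin_nat (fun k => mdist (y n) (y k)) n0 P0.
  by exists m.
(* Only the points [z n] with [P n] and [0 < n] are redirected; injectivity of [z] on [P] makes the
   target unambiguous. *)
have /choice[h Hh] p : exists q,
    (forall n, P n -> (0 < n)%N -> p = z n -> q = y (m n)) /\
    ((forall n, P n -> (0 < n)%N -> p <> z n) -> q = p).
  have [[n [Pn n0 pz]]|np] := pselect (exists n, [/\ P n, (0 < n)%N & p = z n]).
    exists (y (m n)); split=> [k Pk _|/(_ n Pn n0)//].
    by rewrite pz => /(zinj _ _ Pn Pk) ->.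
  by exists p; split=> // n Pn n0 pz; case: np; exists n.
have hz n : P n -> (0 < n)%N -> h (z n) = y (m n).
  by move=> Pn n0; have [H _] := Hh (z n); exact: H.
have hid p : (forall n, P n -> (0 < n)%N -> p <> z n) -> h p = p.
  by have [_] := Hh p.
have hcase p : h p = p \/ exists n, [/\ P n, (0 < n)%N & p = z n].
  have [?|np] := pselect (exists n, [/\ P n, (0 < n)%N & p = z n]); first by right.
  by left; apply: hid => n Pn n0 pz; apply: np; exists n.
have hy n : h (y n) = y n by apply: hid => k _ _; exact: yz.
exists h; split.
- move=> p; have [hp|[n [Pn n0 ->]]] := hcase p; first by rewrite !hp.
  by rewrite hz // hy.
(* Half of [e] bounds the step from [z n] to [y n], the other half the step from [y n] to its
   nearest earlier [y (m n)]. *)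
- move=> e e0; have e20 : 0 < e / 2 by rewrite divr_gt0.
  have [N1 HN1] := zy _ e20.
  have [N2 HN2] := compact_recurrent P cK Ky e20.
  apply: (@sub_finite_set _ _ (z @` `I_(maxn N1 N2))); last first.
    exact/finite_image/finite_II.
  move=> p /= ep; have [hp|[n [Pn n0 pz]]] := hcase p.
    by move: ep; rewrite hp mdistxx leNgt e0.
  exists n => //=; rewrite ltnNge; apply/negP; rewrite geq_max => /andP[n1 n2].
  move: ep; rewrite pz hz // leNgt => /negP; apply.
  have [_ _ Hmin] := Hm n n0; have [k [kn Pk yk]] := HN2 n n2 Pn.
  have := HN1 n n1 Pn; have := Hmin k kn Pk.
  by have := metric_triangle (z n) (y n) (y (m n)); lra.
- move=> n Pn n0; exists (m n); have [? ? _] := Hm n n0; split => //; exact: hz.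
- move=> x xy xz; apply/seteqP; split=> p /=; last first.
    by move=> ->; apply: hid => n _ _; exact: xz.
  have [->//|[n [Pn n0 ->]]] := hcase p.
  by rewrite hz // => /esym/xy.
Qed.

(** By strong induction every [A n] falls in the same half of a separation as [A 0], because it
    meets an earlier set. *)
Lemma connected_chain (T : topologicalType) (A : nat -> set T)
    (P : nat -> Prop) :
  P 0%N -> (forall n, P n -> connected (A n)) ->
  (forall n, P n -> (0 < n)%N ->
     exists m, [/\ (m < n)%N, P m & A n `&` A m !=set0]) ->
  connected (\bigcup_(n in P) A n).
Proof.
move=> P0 cA link; apply/connectedP => E [E0 AE sE].
have AsE n : P n -> A n `<=` E false `|` E true.
  by move=> Pn; rewrite -AE; exact: bigcup_sup.
have [x Ex] := E0 (~~ false).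
wlog A0 : E E0 AE sE AsE x Ex / A 0%N `<=` E false.
  move=> H; have [?|?] := connected_subset sE (AsE _ P0) (cA _ P0).
    exact: (H E E0 AE sE AsE x).
  have [x' Ex'] := E0 false.
  apply: (H (E \o negb) _ _ _ _ x') => //=; first by rewrite AE setUC.
    by rewrite separatedC.
  by move=> n /AsE; rewrite setUC.
have All n : P n -> A n `<=` E false.
  elim/ltn_ind: n => n IH Pn.
  have [->//|n0] := posnP n.
  have [m [mn Pm [w [Anw Amw]]]] := link n Pn n0.
  have [//|AnE] := connected_subset sE (AsE _ Pn) (cA _ Pn).
  case: (setI0P (separated_disjoint sE) (IH m mn Pm _ Amw) (AnE _ Anw)).
have : (\bigcup_(n in P) A n) x by rewrite AE; right.
by move=> [n Pn /(All _ Pn)] Efx; exact: setI0P (separated_disjoint sE) Efx Ex.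
Qed.

(** * Metrizability of subspaces *)

Definition metric_subspace (R : realType) (T : metricType R) (A : set T) : Type := A.

HB.instance Definition _ (R : realType) (T : metricType R) (A : set T) :=
  PseudoMetric.copy (metric_subspace A) (set_type A).

Lemma metric_subspace_ge0 (R : realType) (T : metricType R) (A : set T)
  (x y : metric_subspace A) : 0 <= mdist (set_val x) (set_val y).
Proof. exact: mdist_ge0. Qed.

Lemma metric_subspace_eq0 (R : realType) (T : metricType R) (A : set T)
  (x y : metric_subspace A) : mdist (set_val x) (set_val y) = 0 -> x = y.
Proof. by move/mdist_positivity/val_inj. Qed.

Lemma metric_subspace_ballE (R : realType) (T : metricType R) (A : set T)
  (x : metric_subspace A) d :
  ball x d = [set y : metric_subspace A | mdist (set_val x) (set_val y) < d].
Proof. by rewrite -[LHS]/(set_val @^-1` ball (set_val x) d) ballEmdist. Qed.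

HB.instance Definition _ (R : realType) (T : metricType R) (A : set T) :=
  PseudoMetric_isMetric.Build R (metric_subspace A)
    (@metric_subspace_ge0 R T A) (@metric_subspace_eq0 R T A)
    (@metric_subspace_ballE R T A).

Lemma metrizable_set_type (R : realType) (T : metricType R) (A : set T) :
  metrizable R A.
Proof. by exists (metric_subspace A), id, id; split=> // x; exact: cvg_id. Qed.

Lemma embedding_homeomorphic_range (X Y : topologicalType) (e : X -> Y) :
  hausdorff_space X -> embedding e -> homeomorphic X (range e).
Proof.
move=> hX ee; have [ce eo] := ee; have inje := embedding_inj hX ee.
have re x : range e (e x) by exists x.
pose f x : range e := SigSub (mem_set (re x)).
have /choice[g Hg] (y : range e) : exists x, e x = set_val y.
  by have [x _ ?] := set_valP y; exists x.
exists f, g; split.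
- by move=> x; apply: inje; rewrite Hg.
- by move=> y; apply: val_inj; rewrite /= Hg.
- exact: (@continuous_comp_initial (range e) X Y set_val f ce).
- move=> y N /eo[M]; rewrite Hg => My MN.
  have : nbhs y (set_val @^-1` M) := @initial_continuous (range e) Y set_val y M My.
  by apply: (@filterS _ (nbhs y)) => y' My'; apply: MN; rewrite /preimage /= Hg.
Qed.

Lemma metrizable_hausdorff (R : realType) (X : topologicalType) :
  metrizable R X -> hausdorff_space X.
Proof.
move=> [M [f [g [fK _ cf _]]]] x y xy; rewrite -(fK x) -(fK y); congr g.
apply: metric_hausdorff => A B Ax By.
have [z [? ?]] := xy _ _ (cf x A Ax) (cf y B By); by exists (f z).
Qed.

(** * Invariant coordinates and the assembled compactification *)

Lemma exists_invS_lt (R : realType) (e : R) : 0 < e ->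
  exists n : nat, n.+1%:R^-1 < e.
Proof.
move=> e0; exists (Num.bound e^-1).
rewrite -[ltRHS]invrK ltf_pV2 ?posrE ?invr_gt0 ?ltr0n //.
have /archi_boundP/lt_le_trans : 0 <= e^-1 by rewrite invr_ge0 ltW.
by apply; rewrite ler_nat.
Qed.

(** Countably many invariant functions suffice. An index [(n, d, b)] asks for one that is at most
    1/3 near [j (a n)], at scale [d], and at least 2/3 away from it, at scale [b]; one is chosen
    whenever it exists, and 0 otherwise. [invariant_urysohn] shows that enough indices succeed. *)
Lemma invariant_cube_map (R : realType) (T : metricType R) (h : T -> T)
    (X : topologicalType) (j : X -> T) :
  [set: X] !=set0 -> separable X -> embedding j ->
  (forall p, h (h p) = h p) ->
  (forall e, 0 < e -> finite_set [set p | e <= mdist p (h p)]) ->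
  (forall x, h @^-1` [set j x] = [set j x]) ->
  exists F : T -> cube R (nat * nat * nat)%type,
    [/\ continuous F, forall p, F (h p) = F p &
        forall x N, nbhs (j x) N ->
          exists i, forall p, `|F (j x) i - F p i| < 3^-1 -> N p].
Proof.
move=> X0 sX [cj _] hh finh hj.
have [a dense_a] := separable_dense_sequence sX X0.
pose good (f : T -> R) := continuous f /\ forall p, f (h p) = f p.
pose sep (i : nat * nat * nat) (f : T -> R) :=
  (forall p, mdist (j (a i.1.1)) p < i.1.2.+1%:R^-1 -> f p <= 3^-1) /\
  (forall p, i.2.+1%:R^-1 <= mdist (j (a i.1.1)) p -> 2 / 3 <= f p).
have /choice[F0 HF0] i : exists f, good f /\ ((exists2 g, good g & sep i g) -> sep i f).
  have [[g gg sg]|ng] := pselect (exists2 g, good g & sep i g); first by exists g.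
  exists (fun=> 0); split; last by move/ng.
  by split=> // p; exact: cst_continuous.
pose F p : cube R (nat * nat * nat)%type := fun i => F0 i p.
exists F; split.
- by apply: cube_continuous => i; have [[]] := HF0 i.
- by move=> p; apply/funext => i; have [[_ Hi] _] := HF0 i; exact: Hi.
- move=> x N /nbhs_ballP[e /= e0 eN].
  have e20 : 0 < e / 2 by rewrite divr_gt0.
  have [b] := exists_invS_lt e20; set eb := b.+1%:R^-1 => be.
  have b0 : 0 < eb / 2 by rewrite divr_gt0 ?invr_gt0.
  have [f [cf fh f1 fx fN]] := invariant_urysohn hh finh (hj x) (nbhsx_ballx (j x) _ b0).
  have : nbhs (j x) (f @^-1` ball (f (j x)) 3^-1).
    by apply: cf; apply: nbhsx_ballx; rewrite invr_gt0.
  move=> /nbhs_ballP[c /= c0 fc].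
  have c20 : 0 < c / 2 by rewrite divr_gt0.
  have [d] := exists_invS_lt c20; set ed := d.+1%:R^-1 => dc.
  have d0 : 0 < ed by rewrite invr_gt0.
  have m0 : 0 < Num.min ed (eb / 2) by rewrite lt_min d0.
  (* The dense point is so close to [j x] that its [ed]-ball stays in the [c]-ball of [j x], and its
     [eb]-ball contains the [eb / 2]-ball of [j x]. *)
  have [n] : exists n, (j @^-1` interior (ball (j x) (Num.min ed (eb / 2)))) (a n).
    apply: dense_a; last by exists x; exact: nbhsx_ballx.
    by apply: open_comp => [? _|]; [exact: cj|exact: open_interior].
  move=> /interior_subset; rewrite ballEmdist /= lt_min => /andP[xad xab].
  have sepf : sep (n, d, b) f.
    split=> p /=; rewrite -/ed -/eb => ap.
      have : ball (j x) c p.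
        rewrite ballEmdist /=; have := metric_triangle (j x) (j (a n)) p.
        by move: dc xad ap; lra.
      move/fc; rewrite /preimage /ball /= fx sub0r normrN => /ltW.
      by apply: le_trans; exact: ler_norm.
    rewrite fN; first by lra.
    rewrite ballEmdist /= => xp; have := metric_triangle (j (a n)) (j x) p.
    by rewrite (metric_sym (j (a n)) (j x)); move: xp xab ap; lra.
  have [_ /(_ (ex_intro2 _ _ f (conj cf fh) sepf))[/= Flow Fhigh]] := HF0 (n, d, b).
  exists (n, d, b) => p Fp; apply: eN; rewrite ballEmdist /= ltNge; apply/negP => ep.
  have Fx := Flow (j x); rewrite (metric_sym (j (a n))) in Fx.
  have {}Fx := Fx xad.
  have : 2 / 3 <= F0 (n, d, b) p.
    apply: Fhigh; rewrite -/eb; have := metric_triangle (j x) (j (a n)) p.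
    by move: xab ep be; lra.
  by move: Fp Fx; rewrite /F ltr_norml => /andP[]; lra.
Qed.

(** When [r n] is new, two points of its arc differ only in coordinates [inr k] with [n <= k], whose
    weights are small for large [n]. *)
Lemma wave_arc_dist_cvg0 (R : realType) (r : nat -> cube R nat) (s t e : R) :
  0 < e -> exists N, forall n, (N <= n)%N ->
    (forall k, (k < n)%N -> r k <> r n) ->
    mdist (wave_arc r n s) (wave_arc r n t) < e.
Proof.
move=> e0; have e20 : 0 < e / 2 by rewrite divr_gt0.
have [b be] := exists_invS_lt e20.
have inj_inr : injective (fun k : nat => pickle (inr k : (nat + nat)%type)).
  by move=> k l /(pcan_inj pickleK) [].
have [N HN] := injective_nat_unbounded b inj_inr.
exists N => n Nn newn; apply: (@le_lt_trans _ _ (e / 2)); last by lra.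
apply: cube_dist_le => [|[i|k] /=]; first exact: ltW.
  by rewrite subrr normr0 ge_min ltW.
case: asboolP => [rkn|_]; last by rewrite subrr normr0 ge_min ltW.
have nk : (n <= k)%N by rewrite leqNgt; apply/negP => /newn.
rewrite ge_min; apply/orP; right; apply: le_trans (ltW be).
rewrite /cube_weight lef_pV2 ?posrE ?ltr0n // ler_nat ltnS.
exact/HN/(leq_trans Nn).
Qed.

Lemma exists_first_index (T : Type) (r : nat -> T) n :
  exists2 k, r k = r n & forall i, (i < k)%N -> r i <> r k.
Proof.
elim/ltn_ind: n => n IH.
have [[i il ri]|ni] := pselect (exists2 i, (i < n)%N & r i = r n).
  by have [k rk Hk] := IH i il; exists k => //; rewrite rk.
by exists n => // i il ri; apply: ni; exists i.
Qed.

Lemma cut_point_space_compactification (R : realType) (X : topologicalType) :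
  separable X -> metrizable R X -> cut_point_space X -> [set: X] !=set0 ->
  exists Y : topologicalType,
    [/\ continuum Y, metrizable R Y, reducible Y,
        (forall y : Y, ~ cut_point y)
      & densely_embeds X Y].
Proof.
move=> sX mX cutX X0; have hX := metrizable_hausdorff mX.
have [cX _] := cutX.
have [c [U [V [cutc coinit disj01]]]] := cut_family hX cutX sX X0.
pose W n := c n |` U n.
have conW n : connected (W n) := cut_connected cX (cutc n).
have W0 n : W n !=set0 by exists (c n); left.
have [f ef f1] := separable_metrizable_embedding X0 sX mX.
have /choice[r Hr] n : exists q, closure (f @` W n) q /\ ~ range f q.
  have [q ? ?] := @remainder_point X (cube R nat) f _ (W n)
    (@metric_hausdorff _ _) ef (@cube_compact R nat)
    ltac:(by move=> _ [x _ <-] i; exact: f1) (cut_closed (cutc n))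
    (cut_not_compact hX cutX (cutc n)).
  by exists q.
have rW n : closure (f @` W n) (r n) by have [] := Hr n.
have nr n : ~ range f (r n) by have [] := Hr n.
pose T := cube R (nat + nat)%type.
have hT : hausdorff_space T by exact: metric_hausdorff.
pose j : X -> T := wave_embedding f r.
have ej : embedding j := wave_embeddingP ef nr.
pose arc n : R -> T := wave_arc r n.
have arcW n s : -1 <= s <= 1 -> closure (j @` W n) (arc n s).
  exact: (wave_arc_closure ef nr (conW n) (W0 n) (rW n)).
pose K := closure (range j).
have arcK n s : -1 <= s <= 1 -> K (arc n s).
  by move=> s1; apply: closureS (arcW n s s1); exact: image_subset.
have jK x : K (j x) by apply: subset_closure; exists x.
have cK : compact K.
  have cbox := @cube_compact R (nat + nat)%type.
  apply: (subclosed_compact _ cbox); first exact: closed_closure.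
  rewrite [X in _ `<=` X](iffLR (closure_id _) (compact_closed hT cbox)).
  by apply: closureS => _ [x _ <-] k; exact: wave_embedding_le1.
have I1 : -1 <= (1 : R) <= 1 by lra.
have IN1 : -1 <= (-1 : R) <= 1 by lra.
(* Equal remainder points have the same arc, so only first occurrences are linked. *)
pose new n := forall k, (k < n)%N -> r k <> r n.
have [||||h [hh finh hz hj]] := @linking_map R T K (arc^~ (-1)) (arc^~ 1) new cK
    (fun n => arcK n _ IN1).
- by [].
- by move=> n k /wave_arc_inj[_]; lra.
- move=> n k newn newk /wave_arc_inj[rnk _].
  have [nk|kn|//] := ltngtP n k; first by case: (newk n nk).
  by case: (newn k kn).
- by move=> e e0; exact: wave_arc_dist_cvg0.
have {}hj x : h @^-1` [set j x] = [set j x].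
  by apply: hj => n jx; apply: (wave_arc_notin nr (n := n)); exists x => //; exact: jx.
have [F [cF Fh FN]] := invariant_cube_map X0 sX ej hh finh hj.
have eFj : embedding (F \o j).
  have [cj ejN] := ej; apply: cube_embedding => [i x|x N /ejN[M /FN[i Hi] MN]].
    apply: (@continuous_comp _ _ _ j (fun p => F p i) x (cj x)).
    exact: (@continuous_comp _ _ _ F (fun p => p i) (j x) (cF (j x))
      (@cube_coord_continuous R _ i _)).
  by exists i, 3^-1; [rewrite invr_gt0|move=> y /Hi/MN].
(* The quotient is realized as the image of [K] under the invariant map [F]. By [FN], this keeps
   each point of [X] apart from all other points of [K]. *)
pose B := F @` K.
have cptB : compact B.
  by apply: continuous_compact => //; exact: continuous_subspaceT.
have conB : connected B.
  apply: connected_continuous_connected; last exact: continuous_subspaceT.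
  apply: connected_closure; apply: connected_continuous_connected => //.
  by have [cj _] := ej; exact: continuous_subspaceT.
pose Y : topologicalType := B.
pose pt p (Kp : K p) : Y := SigSub (mem_set (imageP F Kp)).
pose e x : Y := pt (j x) (jK x).
have ee : embedding e.
  apply: (@embedding_factor X Y _ e set_val _ _ eFj).
    exact: (@continuous_comp_initial B X _ set_val e (proj1 eFj)).
  exact: initial_continuous.
have clos S p (y : Y) : closure (j @` S) p -> set_val y = F p -> closure (e @` S) y.
  move=> clp yp N; rewrite nbhsE => -[N' [[O oO ON'] N'y] N'N].
  have Op : nbhs p (F @^-1` O).
    by apply: cF; apply: open_nbhs_nbhs; split => //; rewrite -yp; move: N'y; rewrite -ON'.
  have [_ [[x Sx <-] Ox]] := clp _ Op.
  by exists (e x); split; [exists x|apply: N'N; rewrite -ON'].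
have de : dense (range e).
  move=> O [y Oy] oO; have [p Kp py] := set_valP y.
  have [z [ez Oz]] := clos setT p y Kp (esym py) O (open_nbhs_nbhs (conj oO Oy)).
  by exists z.
have hY : hausdorff_space Y by apply: hausdorff_set_type; exact: metric_hausdorff.
have cY : continuum Y by apply: continuum_set_type => //; exact: metric_hausdorff.
pose arcY n : set Y := set_val @^-1` (F @` (arc n @` [set s | -1 <= s <= 1])).
have arcYP n s (y : Y) : -1 <= s <= 1 -> set_val y = F (arc n s) -> arcY n y.
  by move=> s1 ys; exists (arc n s); [exists s|].
have con_arcY n : connected (arcY n).
  apply: connected_set_val; rewrite set_val_preimageK; last first.
    by move=> _ [_ [s s1 <-] <-]; exists (arc n s) => //; exact: arcK.
  have cI : connected [set s : R | -1 <= s <= 1].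
    by have := @segment_connected R (-1) 1; rewrite set_itvE.
  apply: connected_continuous_connected; last exact: continuous_subspaceT.
  apply: connected_continuous_connected cI _; apply: continuous_subspaceT.
  exact: wave_arc_continuous.
exists Y; split => //.
- exact: metrizable_set_type.
- apply: (reducible_compactification cX cY ee de (cutc 0%N) (cutc 1%N) disj01).
  exists (pt _ (arcK 0%N _ IN1)); split; first exact: (clos _ _ _ (arcW 0%N _ IN1)).
  (* Either the first two arcs coincide, or index 1 is new and the upper end of its arc is glued to
     the lower end of arc 0, the only earlier one. *)
  have [r01|r01] := pselect (r 0%N = r 1%N).
    apply: (clos _ _ _ (arcW 1%N _ IN1)).
    by rewrite -[LHS]/(F (arc 0%N (-1))) /arc (wave_arc_eq r01).
  have new1 : new 1%N by case.
  have [m [+ _ hz1]] := hz 1%N new1 isT; rewrite ltnS leqn0 => /eqP m0.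
  apply: (clos _ _ _ (arcW 1%N _ I1)).
  by rewrite -(Fh (arc 1%N 1)) hz1 m0.
- apply: (@not_cut_point_compactification X Y e (\bigcup_(n in new) arcY n)) => //.
  + apply: connected_chain => // n newn n0.
    have [m [mn newm hzn]] := hz n newn n0; exists m; split => //.
    exists (pt _ (arcK m _ IN1)); split; last exact: (arcYP m _ _ IN1).
    by apply: (arcYP n _ _ I1); rewrite -(Fh (arc n 1)) hzn.
  + apply/seteqP; split=> // y [[n _ [_ [s _ <-] Fs]] [x _ exy]].
    have jxs : j x <> arc n s.
      by move=> jxs; apply: (wave_arc_notin nr (n := n)); exists x => //; exact: jxs.
    have [|i Hi] := FN x (~` [set arc n s]).
      apply: open_nbhs_nbhs; split=> //; rewrite openC.
      exact/accessible_closed_set1/hausdorff_accessible.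
    apply: (Hi (arc n s)) => //; rewrite Fs -exy /= subrr normr0 invr_gt0.
    exact: ltr0n.
  + move=> x U' V' /coinit[n WU].
    (* The arc of the piece [W n] inside the given side may be a repetition; its first occurrence
       [k] belongs to the chain. *)
    have [k rk newk] := exists_first_index r n.
    exists (pt _ (arcK n _ IN1)); split.
      apply: (@closureS _ (e @` W n)).
        by apply: image_subset => z /WU; right.
      exact: (clos _ _ _ (arcW n _ IN1)).
    exists k => //; apply: (arcYP k _ _ IN1).
    by rewrite -[LHS]/(F (arc n (-1))) /arc (wave_arc_eq rk).
- by exists (range e) => //; exact: embedding_homeomorphic_range.
Qed.

Theorem theorem4p6 (R : realType) (X : topologicalType)
    (X_separable : separable X) (X_metrizable : metrizable R X)
    (X_cut : cut_point_space X) :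
  exists Y : topologicalType,
    [/\ continuum Y, metrizable R Y, reducible Y,
        (forall y : Y, ~ cut_point y)
      & densely_embeds X Y].
Proof.
(* An empty [X] serves as its own [Y]. *)
have [X0|nX] := pselect ([set: X] !=set0).
  exact: cut_point_space_compactification.
have absX (x : X) : False by apply: nX; exists x.
have hX := metrizable_hausdorff X_metrizable.
exists X; split => //.
- split => //; first by have [] := X_cut.
  rewrite (_ : [set: X] = set0); first exact: compact0.
  by apply/seteqP; split=> x; case: (absX x).
- exists (range (@id X)); first by move=> O [x]; case: (absX x).
  exact: embedding_homeomorphic_range.
Qed.
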